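(* Let $R$ and $S$ be rings. (i) If $R$ and $S$ are F-noetherian, then so is $R\times S$. (ii) If $R$ and $S$ are tightly F-noetherian, then so is $R\times S$.
   Context: All rings have an identity $1$, and subrings contain $1$; ''noetherian'' means left and right noetherian. A ring $R$ is F-noetherian if every finite subset of $R$ is contained in a noetherian subring of $R$; it is tightly F-noetherian if every finite subset of $R$ generates (as a ring) a noetherian subring of $R$. *)

(* Defs.v *)
From mathcomp Require Import all_boot all_algebra.
From mathcomp Require Import boolp classical_sets cardinality.

Set Implicit Arguments.
Unset Strict Implicit.
Unset Printing Implicit Defensive.

Import GRing.Theory.
Local Open Scope ring_scope.
Local Open Scope classical_set_scope.

(* Rings are [pzRingType]s: unital, not necessarily commutative, the zero ring
   being allowed.  Subrings are Prop-valued subsets; they contain 1 since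
   [GRing.subring_closed] requires it. *)
Definition subring (R : pzRingType) (A : set R) : Prop :=
  GRing.subring_closed [in A].

(* In the next three definitions [A] is meant to be a subring of [R], and the
   ideals are those of the ring [A], not of [R]. *)
Definition left_ideal (R : pzRingType) (A I : set R) : Prop :=
  [/\ I `<=` A, GRing.zmod_closed [in I] &
      forall a x, A a -> I x -> I (a * x)].

Definition right_ideal (R : pzRingType) (A I : set R) : Prop :=
  [/\ I `<=` A, GRing.zmod_closed [in I] &
      forall a x, A a -> I x -> I (x * a)].

(* Ascending chain condition on the subsets of [T] satisfying [P]. *)
Definition acc (T : Type) (P : set T -> Prop) : Prop :=
  forall I : nat -> set T,
    (forall n, P (I n)) -> (forall n, I n `<=` I n.+1) ->
    exists N, forall n, (N <= n)%N -> I n = I N.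

Definition noetherian (R : pzRingType) (A : set R) : Prop :=
  acc (left_ideal A) /\ acc (right_ideal A).

Definition subring_generated (R : pzRingType) (F : set R) : set R :=
  smallest (@subring R) F.

Definition F_noetherian (R : pzRingType) : Prop :=
  forall F : set R, finite_set F ->
    exists A : set R, [/\ subring A, noetherian A & F `<=` A].

Definition tightly_F_noetherian (R : pzRingType) : Prop :=
  forall F : set R, finite_set F -> noetherian (subring_generated F).

(* Main.v *)
Require Import Defs.
From mathcomp Require Import all_boot all_algebra.
From mathcomp Require Import boolp classical_sets cardinality.

Set Implicit Arguments.
Unset Strict Implicit.
Unset Printing Implicit Defensive.

Import GRing.Theory.
Local Open Scope ring_scope.
Local Open Scope classical_set_scope.

(** Both parts follow from one fact ([noetherian_subdirect]): a subring [T] of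
    [R * S] is noetherian as soon as its two projections are. The second
    projection makes the kernel of [T -> R] a module over [snd @` T], so a
    one-sided ideal [I] of [T] is controlled by two one-sided ideals of
    noetherian rings: its image [fst @` I] in [fst @` T], and its fiber
    [[set s | I (0, s)]] over [0] in [snd @` T]. If [I] is contained in [J] and
    both have the same image and the same fiber, then [I = J]: an element of
    [J] differs from some element of [I] by an element of [J] of the form
    [(0, s)], which is in [I]. Hence an ascending chain of ideals of [T]
    stops as soon as the two induced chains have stopped
    ([acc_image_fiber]).

    For F-noetherian rings, take [T = A `*` B] with [A] and [B] noetherian
    subrings containing the two projections of the given finite set. For
    tightly F-noetherian rings, take for [T] the subring generated by the
    finite set [F]; as a ring morphism carries the subring generated by a set
    onto the one generated by its image ([image_subring_generated]), the
    projections of [T] are finitely generated, hence noetherian. *)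

Lemma zmod_closedP (V : zmodType) (I : set V) :
  GRing.zmod_closed [in I] <-> I 0 /\ forall x y, I x -> I y -> I (x - y).
Proof.
split=> [[I0 IB]|[I0 IB]].
  split=> [|x y Ix Iy]; first exact: set_mem.
  by apply: set_mem; apply: IB; apply: mem_set.
split=> [|x y /set_mem Ix /set_mem Iy]; first exact: mem_set.
by apply: mem_set; apply: IB.
Qed.

Lemma subringP (R : pzRingType) (A : set R) :
  subring A <-> [/\ A 1, forall x y, A x -> A y -> A (x - y)
                 & forall x y, A x -> A y -> A (x * y)].
Proof.
split=> [[A1 AB AM]|[A1 AB AM]].
  split=> [|x y Ax Ay|x y Ax Ay]; first exact: set_mem.
    by apply: set_mem; apply: AB; apply: mem_set.
  by apply: set_mem; apply: AM; apply: mem_set.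
split=> [|x y /set_mem Ax /set_mem Ay|x y /set_mem Ax /set_mem Ay].
- exact: mem_set.
- by apply: mem_set; apply: AB.
- by apply: mem_set; apply: AM.
Qed.

Lemma subring0 (R : pzRingType) (A : set R) : subring A -> A 0.
Proof. by move=> /subringP[A1 AB _]; rewrite -(subrr 1); apply: AB. Qed.

Lemma chain_le (T : Type) (I : nat -> set T) :
  (forall n, I n `<=` I n.+1) -> forall m n, (m <= n)%N -> I m `<=` I n.
Proof.
move=> mono m n /subnK <-; elim: (n - m)%N => [//|k IHk] x Ix.
by rewrite addSn; apply: mono; apply: IHk.
Qed.

(** Stated for arbitrary families of additive subgroups, so that it serves for
    left and for right ideals alike. *)
Lemma acc_image_fiber (U V : zmodType) (P : set (U * V) -> Prop)
    (PU : set U -> Prop) (PV : set V -> Prop) :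
  (forall I, P I -> GRing.zmod_closed [in I]) ->
  (forall I, P I -> PU (fst @` I)) ->
  (forall I, P I -> PV [set v | I (0, v)]) ->
  acc PU -> acc PV -> acc P.
Proof.
move=> Pzmod Pfst Pfiber accU accV I PI mono.
have [M stopM] : exists N, forall n, (N <= n)%N -> fst @` I n = fst @` I N.
  by apply: accU => n; [exact: Pfst|exact: image_subset].
have [N stopN] : exists N, forall n, (N <= n)%N ->
    [set v | I n (0, v)] = [set v | I N (0, v)].
  by apply: (accV (fun n => [set v | I n (0, v)])) => n;
    [exact: Pfiber|move=> v /=; exact: mono].
exists (maxn M N) => n; rewrite geq_max => /andP[leMn leNn].
apply/seteqP; split=> x; last by apply: chain_le; rewrite // geq_max leMn.
move=> Inx.
have [y IMy yx1] : (fst @` I M) x.1 by rewrite -(stopM n leMn); exists x.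
have IB k u w : I k u -> I k w -> I k (u - w).
  by have /zmod_closedP[_] := Pzmod _ (PI k); apply.
have I0 k : I k 0 by have /zmod_closedP[] := Pzmod _ (PI k).
have INd : I N (0, x.2 - y.2).
  suff : [set v | I N (0, v)] (x.2 - y.2) by [].
  rewrite -(stopN n leNn) /= -(subrr x.1) -{2}yx1.
  exact: IB Inx (chain_le mono leMn IMy).
(* The sum of [(0, x.2 - y.2)] and [y], written with the subtractions under
   which additive subgroups are closed. *)
have -> : x = (0, x.2 - y.2) - (0 - y).
  rewrite sub0r opprK; case: x y yx1 {Inx IMy INd} => [x1 x2] [y1 y2] /= <-.
  by rewrite -[RHS]/(0 + y1, x2 - y2 + y2) add0r subrK.
apply: (IB); first exact: chain_le mono _ _ (leq_maxr M N) _ INd.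
by apply: IB => //; exact: chain_le mono _ _ (leq_maxl M N) _ IMy.
Qed.

Lemma zmod_closed_fst (U V : zmodType) (I : set (U * V)) :
  GRing.zmod_closed [in I] -> GRing.zmod_closed [in fst @` I].
Proof.
move=> /zmod_closedP[I0 IB]; apply/zmod_closedP; split; first by exists 0.
by move=> _ _ [x Ix <-] [y Iy <-]; exists (x - y) => //; exact: IB.
Qed.

Lemma zmod_closed_fiber (U V : zmodType) (I : set (U * V)) :
  GRing.zmod_closed [in I] -> GRing.zmod_closed [in [set v | I (0, v)]].
Proof.
move=> /zmod_closedP[I0 IB]; apply/zmod_closedP; split=> //= x y Ix Iy.
by rewrite -(subr0 0); exact: IB Ix Iy.
Qed.

(** The fiber of [I] over [0] is stable under multiplication by [snd @` T]
    because [t * (0, s) = (0, t.2 * s)]: an element of [snd @` T] acts through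
    any of its lifts [t] to [T]. *)
Lemma noetherian_subdirect (R S : pzRingType) (T : set (R * S)%type) :
  noetherian (fst @` T) -> noetherian (snd @` T) -> noetherian T.
Proof.
move=> [accl1 accr1] [accl2 accr2]; split.
- apply: acc_image_fiber accl1 accl2 => I [IT Iz IM] //.
    split; [exact: image_subset|exact: zmod_closed_fst|].
    by move=> _ _ [t Tt <-] [x Ix <-]; exists (t * x) => //; exact: IM.
  split; [|exact: zmod_closed_fiber|].
    by move=> s Is; exists (0, s) => //; exact: IT.
  by move=> _ s [t Tt <-] Is /=; rewrite -(mulr0 t.1); exact: IM Tt Is.
- apply: acc_image_fiber accr1 accr2 => I [IT Iz IM] //.
    split; [exact: image_subset|exact: zmod_closed_fst|].
    by move=> _ _ [t Tt <-] [x Ix <-]; exists (x * t) => //; exact: IM.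
  split; [|exact: zmod_closed_fiber|].
    by move=> s Is; exists (0, s) => //; exact: IT.
  by move=> _ s [t Tt <-] Is /=; rewrite -(mul0r t.1); exact: IM Tt Is.
Qed.

Lemma subring_setX (R S : pzRingType) (A : set R) (B : set S) :
  subring A -> subring B -> subring (A `*` B : set (R * S)%type).
Proof.
move=> /subringP[A1 AB AM] /subringP[B1 BB BM]; apply/subringP; split=> //.
  by move=> x y [Ax Bx] [Ay By]; split; [exact: AB|exact: BB].
by move=> x y [Ax Bx] [Ay By]; split; [exact: AM|exact: BM].
Qed.

Lemma subring_image (R S : pzRingType) (f : {rmorphism R -> S}) (A : set R) :
  subring A -> subring (f @` A).
Proof.
move=> /subringP[A1 AB AM]; apply/subringP; split.
- by exists 1 => //; exact: rmorph1.
- move=> _ _ [x Ax <-] [y Ay <-].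
  by exists (x - y); [exact: AB|exact: rmorphB].
- move=> _ _ [x Ax <-] [y Ay <-].
  by exists (x * y); [exact: AM|exact: rmorphM].
Qed.

Lemma subring_preimage (R S : pzRingType) (f : {rmorphism R -> S})
    (B : set S) : subring B -> subring (f @^-1` B).
Proof.
move=> /subringP[B1 BB BM]; apply/subringP; split.
- by rewrite /preimage /= rmorph1.
- by move=> x y Bx By; rewrite /preimage /= rmorphB; exact: BB.
- by move=> x y Bx By; rewrite /preimage /= rmorphM; exact: BM.
Qed.

Lemma subring_subring_generated (R : pzRingType) (F : set R) :
  subring (subring_generated F).
Proof.
apply/subringP; split.
- by move=> A [/subringP[A1 _ _] _].
- move=> x y Gx Gy A [Asub FA]; have /subringP[_ AB _] := Asub.
  by apply: AB; [exact: Gx|exact: Gy].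
- move=> x y Gx Gy A [Asub FA]; have /subringP[_ _ AM] := Asub.
  by apply: AM; [exact: Gx|exact: Gy].
Qed.

(** The preimage of a subring containing [f @` F] contains the subring
    generated by [F], and the image of the latter is a subring containing
    [f @` F]. *)
Lemma image_subring_generated (R S : pzRingType) (f : {rmorphism R -> S})
    (F : set R) :
  f @` subring_generated F = subring_generated (f @` F).
Proof.
apply/seteqP; split.
  move=> _ [x Gx <-] B [Bsub FB]; apply: (Gx (f @^-1` B)).
  split; first exact: subring_preimage.
  by move=> y Fy; apply: FB; exists y.
apply: smallest_sub; first exact/subring_image/subring_subring_generated.
by apply: image_subset; exact: sub_gen_smallest.
Qed.

Theorem proposition3p7 (R S : pzRingType) :
  (F_noetherian R -> F_noetherian S -> F_noetherian (R * S)%type) /\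
  (tightly_F_noetherian R -> tightly_F_noetherian S ->
     tightly_F_noetherian (R * S)%type).
Proof.
split=> [FR FS F finF|tFR tFS F finF].
  have [A [Asub Anoeth FA]] := FR _ (finite_image fst finF).
  have [B [Bsub Bnoeth FB]] := FS _ (finite_image snd finF).
  exists (A `*` B); split; first exact: subring_setX.
    apply: noetherian_subdirect.
      suff -> : fst @` (A `*` B) = A by [].
      apply/seteqP; split=> [_ [x [Ax _] <-] //|a Aa].
      by exists (a, 0) => //; split=> //; exact: subring0.
    suff -> : snd @` (A `*` B) = B by [].
    apply/seteqP; split=> [_ [x [_ Bx] <-] //|b Bb].
    by exists (0, b) => //; split=> //; exact: subring0.
  by move=> x Fx; split; [apply: FA|apply: FB]; exists x.
apply: noetherian_subdirect.
  by rewrite image_subring_generated; exact/tFR/finite_image.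
by rewrite image_subring_generated; exact/tFS/finite_image.
Qed.
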